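(* Let $n,p,c$ be positive integers and let $b=pc+1$. Let $k\in\{1,\dots,n\}$ and let $0<s_1<s_2<\cdots<s_k\le n$ be integers; put $s_0:=0$ and $s_{k+1}:=n$. Let $P(s_1,\dots,s_k)$ be the probability that the set of positions $i\in\{1,\dots,n\}$ at which the $(b,n,p)$-shuffle has a d-descent is exactly $\{s_1,\dots,s_k\}$. Then the following hold. (1) If $s_k<n$, then $$P(s_1,\dots,s_k)=\frac{1}{b^n}\det\bigl(f(i,j)\bigr)_{i,j=0,\dots,k},$$ where $$f(i,j)=\begin{cases}\dbinom{s_{j+1}-s_i+b-1}{b-1} & (0\le i\le k,\ 0\le j\le k-1),\\[2mm] \dbinom{n-s_i+c}{c} & (0\le i\le k,\ j=k).\end{cases}$$ (2) If $s_k=n$, then $$P(s_1,\dots,s_{k-1},n)=\frac{1}{b^n}\det\bigl(f(i,j)\bigr)_{i,j=0,\dots,k-1},$$ where $$f(i,j)=\begin{cases}\dbinom{s_{j+1}-s_i+b-1}{b-1} & (0\le i\le k-1,\ 0\le j\le k-2),\\[2mm] \dbinom{n-s_i+b-1}{b-1}-\dbinom{n-s_i+c}{c} & (0\le i\le k-1,\ j=k-1).\end{cases}$$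
   Context: Colored permutations. Let $[n]=\{1,\dots,n\}$, $\Sigma=[n]\times\mathbf{Z}_p$ with $\mathbf{Z}_p=\mathbf{Z}/p\mathbf{Z}$ (elements represented by $0,1,\dots,p-1$), and $T_q(i,r)=(i,r+q)$ for $q \in \mathbf{Z}_p$. $G_{p,n}$ is the group of bijections $\sigma:\Sigma\to\Sigma$ with $\sigma\circ T_1=T_1\circ\sigma$. An element $\sigma\in G_{p,n}$ is determined by the pairs $(\sigma(i),\sigma_c(i)):=\sigma(i,0)$, $i\in[n]$, and is written $\sigma=\bigl((\sigma(1),\sigma_c(1)),\dots,(\sigma(n),\sigma_c(n))\bigr)$. d-descents. Order $\Sigma$ linearly by $(1,0)<(2,0)<\cdots<(n,0)<(1,p-1)<\cdots<(n,p-1)<(1,p-2)<\cdots<(n,p-2)<\cdots<(1,1)<\cdots<(n,1)$. $\sigma\in G_{p,n}$ has a d-descent at $i$, for $1\le i\le n-1$, iff $(\sigma(i),\sigma_c(i))>(\sigma(i+1),\sigma_c(i+1))$; it has a d-descent at $n$ iff $\sigma_c(n)\ne 0$. $(b,n,p)$-shuffle. This is the random element of $G_{p,n}$ obtained as follows. Choose $\mathbf{A}=(A_1,\dots,A_n)$ uniformly at random in $\{0,1,\dots,b-1\}^n$. Arrange $A_1,\dots,A_n$ in ascending order, $A_{i(1)}\le A_{i(2)}\le\cdots\le A_{i(n)}$, where equal labels are kept in increasing order of their indices, and define the permutation part of $\sigma$ by $\sigma(i(m))=m$ for $m=1,\dots,n$. Define the colors by $\sigma_c(i)\equiv A_i\pmod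 p$. (Example: $(b,n,p)=(5,4,3)$, $\mathbf A=(4,0,2,4)$ gives $\sigma=((3,1),(1,0),(2,2),(4,1))$.) Convention: $\binom{N}{K}=0$ whenever $N<K$ (in particular when $N<0$), for $K\ge 0$; so $f(i,j)=0$ for those entries of the first type with $s_{j+1}<s_i$. *)

(* Defs.v *)
From HB Require Import structures.
From mathcomp Require Import all_boot all_order all_fingroup all_algebra.

Set Implicit Arguments.
Unset Strict Implicit.
Unset Printing Implicit Defensive.

Import GRing.Theory.
Local Open Scope ring_scope.

(* Z/pZ for every p >= 1: 'I_p.-1.+1 carries addition modulo p.-1.+1 = p.
   The library's 'Z_p is not used because 'Z_1 has two elements. *)
Notation color p := ('I_p.-1.+1).

(* [n] is represented by 'I_n, so the letter i of [n] is the ordinal i - 1. *)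
Notation letter n p := (('I_n * color p)%type).

Definition shift n p (q : color p) (x : letter n p) : letter n p :=
  (x.1, x.2 + q).

Definition colored_perms n p : {set {perm letter n p}} :=
  [set s : {perm letter n p} |
    [forall x, s (shift (inZp 1) x) == shift (inZp 1) (s x)]].

Lemma colored_perms_group_set n p : group_set (colored_perms n p).
Proof.
apply/group_setP; split=> [|s t].
  by rewrite inE; apply/forallP=> x; rewrite !perm1.
rewrite !inE => /forallP hs /forallP ht; apply/forallP=> x.
by rewrite !permM (eqP (hs x)) (eqP (ht _)).
Qed.

Canonical colored_perms_group n p : {group {perm letter n p}} :=
  Group (colored_perms_group_set n p).

Notation colored_perm n p := [subg (colored_perms_group n p)].

(* (sigma(i), sigma_c(i)) = sigma(i, 0) *)
Definition entry n p (s : colored_perm n p) (i : 'I_n) : letter n p :=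
  sgval s (i, 0).

(* The order (1,0) < ... < (n,0) < (1,p-1) < ... < (n,p-1) < ... < (n,1):
   r |-> - r sends the colors 0, p-1, p-2, ..., 1 to 0, 1, 2, ..., p-1. *)
Definition letter_lt n p (x y : letter n p) : bool :=
  ((- x.2 : color p) < (- y.2 : color p))%N
  || ((x.2 == y.2) && (x.1 < y.1)%N).

(* i : 'I_n stands for the position i.+1 of {1, ..., n}; when i.+1 < n,
   ordS i is the ordinal i.+1, i.e. the next position. *)
Definition d_descent n p (s : colored_perm n p) (i : 'I_n) : bool :=
  if (i.+1 < n)%N then letter_lt (entry s (ordS i)) (entry s i)
  else (entry s i).2 != 0.

Definition d_descent_set n p (s : colored_perm n p) : {set 'I_n} :=
  [set i | d_descent s i].

Section Shuffle.
Variables (b n p : nat) (A : {ffun 'I_n -> 'I_b}).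

Definition label_le (i j : 'I_n) : bool :=
  (A i < A j)%N || ((A i == A j) && (i <= j)%N).

(* i(1), ..., i(n) *)
Definition arrangement : seq 'I_n := sort label_le (enum 'I_n).

Lemma index_arrangement_lt (i : 'I_n) : (index i arrangement < n)%N.
Proof.
by rewrite -[X in (_ < X)%N]size_enum_ord -(size_sort label_le) index_mem
           mem_sort mem_enum.
Qed.

Definition shuffle_rank (i : 'I_n) : 'I_n := Ordinal (index_arrangement_lt i).

Lemma shuffle_rank_inj : injective shuffle_rank.
Proof.
move=> i j [] /(congr1 (nth i arrangement)).
by rewrite !nth_index // mem_sort mem_enum.
Qed.

(* sigma(i, r) = T_r (sigma(i, 0)), with sigma(i, 0) = (rank of i, A_i mod p) *)
Definition shuffle_fun (x : letter n p) : letter n p :=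
  shift x.2 (shuffle_rank x.1, inZp (A x.1)).

Lemma shuffle_fun_inj : injective shuffle_fun.
Proof.
move=> [i r] [j t] e; have /shuffle_rank_inj /= ij := congr1 fst e.
by have := congr1 snd e; rewrite /= ij => /addrI ->.
Qed.

Lemma shuffle_fun_colored : perm shuffle_fun_inj \in colored_perms_group n p.
Proof.
rewrite inE; apply/forallP=> x; rewrite !permE /shuffle_fun /shift /=.
by rewrite addrA.
Qed.

Definition shuffle : colored_perm n p := Subg shuffle_fun_colored.

End Shuffle.

Arguments shuffle {b n} p A.

Definition uniform_prob (Omega : finType) (E : {set Omega}) : rat :=
  #|E|%:R / #|Omega|%:R.

Definition prob_d_descent_set b n p (S : {set 'I_n}) : rat :=
  uniform_prob [set A : {ffun 'I_n -> 'I_b} |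
                 d_descent_set (shuffle p A) == S].

(* The positions s 1, ..., s k of {1, ..., n}. *)
Definition positions n k (s : nat -> nat) : {set 'I_n} :=
  [set i : 'I_n | [exists m : 'I_k, i.+1 == s m.+1]].

(* Binomial coefficient with the convention that it vanishes when N < K,
   including N < 0. *)
Definition binz (N : int) (K : nat) : rat :=
  if N is Posz m then 'C(m, K)%:R else 0.

(* Main.v *)
Require Import Defs.
From mathcomp Require Import all_boot all_order all_fingroup all_algebra.
From mathcomp Require Import zify ring.
Set Implicit Arguments.
Unset Strict Implicit.
Unset Printing Implicit Defensive.

Import GRing.Theory.
Local Open Scope ring_scope.

(** Why the theorem is true.

    The letters with the same color are compared by rank, and ranks increase
    with the labels; hence a d-descent of the shuffle at i < n is a strict
    decrease from the label at i to the next one, for the total order on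
    {0, ..., b-1} that lists the c+1 multiples of p first, then the classes of
    p-1, p-2, ..., 1 modulo p, each class being in increasing order. Numbering
    the labels along this order ([relabel]) is a bijection of {0, ..., b-1},
    so the labels become a uniform word w_1 ... w_n whose descents are the
    d-descents at i < n, and the d-descent at n says w_n > c. With virtual
    letters w_0 = 0 and w_{n+1} = c, all these conditions read: w_q > w_{q+1}
    exactly when q is prescribed, for 0 <= q <= n ([card_d_descent_set]).

    Let U and V be the 0-1 matrices of weak ascents and of descents on
    {0, ..., b-1} ([step_mx]). The number of words with a given descent pattern
    is the entry (0, c) of the product of the corresponding matrices
    ([card_words_step_mx]). Two facts evaluate it: powers of U have binomial
    entries ([ascending_step_mxX]), and U + V is the all-ones matrix, which has
    rank one, so that a word without condition at some place splits into two
    independent words ([mul_const_mx_split]).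

    Let D_j count the words on the positions s_j + 1, ..., n that have the
    prescribed pattern there, and X_{i,j} those on s_i + 1, ..., n that
    ascend weakly up to s_{j+1} and follow the pattern from s_{j+1} on.
    Removing the condition at s_{j+1} gives
    f(i,j) D_{j+1} = X_{i,j} + X_{i,j+1}, while X_{i,i} = D_i; in the last column
    f(i,j) is X_{i,j} itself, and D_{j+1} stands for 1. The alternating sum over
    j telescopes, so (f(i,j)) maps the vector with entries
    (-1)^j D_{j+1} to D_0 times the first basis vector. As (f(i,j)) is a
    Hessenberg matrix with ones below the diagonal, this forces
    det (f(i,j)) = D_0 ([det_unit_hessenberg], [det_descent_pattern]). The two
    parts of the theorem are the two possible conditions at n, which only
    affect the last column. *)

(** * Unit Hessenberg determinants *)

(** This is Cramer's rule for the last unknown: the minor that multiplies [d] is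
    obtained by deleting the first row and the last column, and it is
    triangular with ones on the diagonal. *)
Lemma det_unit_hessenberg (R : comNzRingType) K (M : 'M[R]_K.+1) (v : 'cV[R]_K.+1)
    (d : R) :
  (forall i j : 'I_K.+1, i = j.+1 :> nat -> M i j = 1) ->
  (forall i j : 'I_K.+1, (j.+1 < i)%N -> M i j = 0) ->
  M *m v = d *: delta_mx 0 0 -> v ord_max 0 = (-1) ^+ K ->
  \det M = d.
Proof.
move=> M1 M0 Mv vK.
have /(congr1 (fun u : 'cV_K.+1 => u ord_max 0)) :
    \det M *: v = d *: (\adj M *m delta_mx 0 0).
  by rewrite scalemxAr -Mv mulmxA mul_adj_mx mul_scalar_mx.
rewrite -colE !mxE vK /cofactor /= add0n.
have -> : \det (row' 0 (col' ord_max M)) = 1.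
  rewrite -det_tr det_trig => [|].
    by rewrite big1 // => i _; rewrite !mxE M1 // lift0 lift_max.
  by apply/is_trig_mxP=> i j ij; rewrite !mxE M0 // lift0 lift_max ltnS.
by rewrite mulr1 ![_ * (-1) ^+ K]mulrC => /(@lreg_sign R K).
Qed.

(** * Words and products of step matrices *)

Section Steps.
Variable b : nat.
Implicit Types (d : bool) (x y z : 'I_b.+1).

Definition step_mx d : 'M[rat]_b.+1 := \matrix_(x, y) ((y < x)%N == d)%:R.

(** The letters [x] and [z] at both ends are fixed, which lets the conditions on
    the first and last letters of a word be steps like the others. *)
Lemma card_words_step_mx m (ds : seq bool) x z : size ds = m.+1 ->
  #|[set t : m.-tuple 'I_b.+1 |
      pairmap (fun u v : 'I_b.+1 => (v < u)%N) x (rcons t z) == ds]|%:R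
    = (\prod_(d <- ds) step_mx d) x z.
Proof.
rewrite -sum1_card natr_sum big_mkcond /=.
elim: m ds x => [|m IHm] [|d ds] x // [] sz_ds.
  case: ds sz_ds => // _; rewrite big_seq1 mxE.
  rewrite (bigD1 [tuple]) //= big1 => [|t /eqP[]]; last exact: tuple0.
  by rewrite inE /= eqseq_cons eqxx andbT addr0; case: eqP.
rewrite big_cons mxE.
rewrite (reindex (fun ut : 'I_b.+1 * m.-tuple 'I_b.+1 => [tuple of ut.1 :: ut.2]))
  /=; last first.
  exists (fun t => (thead t, [tuple of behead t])) => [[u t] _|t _] /=.
    by congr (_, _); apply: val_inj.
  by rewrite -tuple_eta.
rewrite -(pair_bigA _ (fun u (t : m.-tuple _) =>
  if [tuple of u :: t] \in _ then 1 else 0)) /=.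
apply: eq_bigr => u _; rewrite -IHm // mxE big_distrr /=; apply: eq_bigr => t _.
by rewrite !inE /= eqseq_cons; case: (_ == d); case: (_ == ds);
   rewrite ?mulr1 ?mulr0 ?mul0r.
Qed.

Lemma step_mxD : step_mx true + step_mx false = const_mx 1.
Proof. by apply/matrixP=> x y; rewrite !mxE; case: (_ < _)%N. Qed.

(** The all-ones matrix forgets which letter was reached. The sum of all entries
    of a row of [A] is recovered by an ascent to the largest letter, and the sum
    of a column of [B] by an ascent from the smallest one. *)
Lemma mul_const_mx_split (A B : 'M[rat]_b.+1) x z :
  (A * const_mx 1 * B) x z
    = (A * step_mx false) x ord_max * (step_mx false * B) ord0 z.
Proof.
rewrite -!mulmxE !mxE; under eq_bigr => u _ do rewrite mxE.
have -> : \sum_(u < b.+1) A x u * step_mx false u ord_max = \sum_u A x u.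
  by apply: eq_bigr => u _; rewrite mxE ltnNge -ltnS ltn_ord mulr1.
have -> : \sum_(v < b.+1) step_mx false ord0 v * B v z = \sum_v B v z.
  by apply: eq_bigr => v _; rewrite mxE mul1r.
rewrite big_distrr; apply: eq_bigr => v _; congr (_ * _).
by apply: eq_bigr => u _; rewrite mxE mulr1.
Qed.

Lemma hockey_stick m l h : (l <= h)%N ->
  (\sum_(l <= u < h.+1) 'C(m + (h - u), m) = 'C((m + (h - l)).+1, m.+1))%N.
Proof.
move=> /subnK <-; move: (h - l)%N => d; elim: d l => [|d IHd] l.
  by rewrite add0n big_nat1 !subnn addn0 !binn.
rewrite big_ltn; last lia.
rewrite addSnnS IHd -addSnnS !addnK addnS [in RHS]binS addnC.
by congr ('C(_, _) + 'C(_, _))%N; lia.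
Qed.

(** Between [x] and [z] there are [m] intermediate letters, which form a multiset
    of size [m] in an interval of [(z - x).+1] letters. *)
Lemma ascending_step_mxX m x z :
  (step_mx false ^+ m.+1) x z = if (x <= z)%N then 'C(m + (z - x), m)%:R else 0.
Proof.
elim: m x => [|m IHm] x.
  by rewrite expr1 mxE bin0 ltnNge; case: (_ <= _)%N.
rewrite exprS -mulmxE mxE.
transitivity ((\sum_(x <= u < z.+1) 'C(m + (z - u), m))%N%:R : rat).
  rewrite natr_sum big_geq_mkord (big_ord_widen_cond b.+1 (fun u => x <= u)%N
    (fun u => 'C(m + (z - u), m)%:R) (ltn_ord z)) [RHS]big_mkcond.
  apply: eq_bigr => u _; rewrite mxE IHm ltnS eqbF_neg -leqNgt.
  by case: (x <= u)%N; case: (u <= z)%N; rewrite ?mul1r ?mul0r.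
case: leqP => xz; first by rewrite hockey_stick // addSn.
by rewrite big_geq.
Qed.

Lemma ascending_words_last m z :
  (step_mx false ^+ m * step_mx false) ord0 z = 'C(m + z, z)%:R.
Proof.
by rewrite -exprSr ascending_step_mxX /= subn0 -bin_sub ?leq_addr // addKn.
Qed.

(** The words whose last letter exceeds [z] are all ascending words but those
    that stay at most [z]. *)
Lemma descending_words_last m z :
  (step_mx false ^+ m * step_mx true) ord0 z = 'C(m + b, b)%:R - 'C(m + z, z)%:R.
Proof.
rewrite -(ascending_words_last m z) -(ascending_words_last m ord_max).
rewrite -[step_mx true](addrK (step_mx false)) step_mxD mulrBr !mxE.
congr (_ - _); apply: eq_bigr => u _.
by rewrite !mxE ltnNge -ltnS ltn_ord.
Qed.

End Steps.

(** * The determinant of a descent pattern *)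

Section DescentPattern.
Variables (b n K : nat) (s : nat -> nat) (desc : nat -> bool) (z : 'I_b.+1).
Hypotheses (s_lt : forall i, (i <= K)%N -> (s i < s i.+1)%N) (sK : s K.+1 = n).
Hypotheses (s0 : s 0 = 0%N) (desc0 : ~~ desc 0).
Hypothesis desc_s : forall i, (0 < i <= K)%N -> desc (s i).
Hypothesis ascent_gap : forall i q, (i <= K)%N -> (s i < q < s i.+1)%N -> ~~ desc q.

Local Notation U := (step_mx b false).

Definition suffix_mx l : 'M[rat]_b.+1 := \prod_(l <= q < n.+1) step_mx b (desc q).

(** Counts the words that ascend from the virtual letter 0 at position [s i] up to
    position [s j.+1], and follow the pattern from there on. *)
Definition merged_words i j : rat := (U ^+ (s j.+1 - s i) * suffix_mx (s j.+1)) ord0 z.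

Lemma breakpoint_mono i j : (i <= j <= K.+1)%N -> (s i <= s j)%N.
Proof.
case/andP=> ij; elim: j ij => [|j IHj]; first by rewrite leqn0 => /eqP->.
rewrite leq_eqVlt => /predU1P[-> // | ij] jK.
by apply: leq_trans (IHj ij (ltnW jK)) (ltnW (s_lt jK)).
Qed.

Lemma suffix_mx_gap i : (i <= K)%N ->
  suffix_mx (s i).+1 = U ^+ (s i.+1 - (s i).+1) * suffix_mx (s i.+1).
Proof.
move=> iK; have si_n : (s i.+1 <= n)%N by rewrite -sK breakpoint_mono // ltnS iK leqnn.
rewrite /suffix_mx (big_cat_nat (s_lt iK)) /=; last by rewrite ltnW ?ltnS.
congr (_ * _); rewrite -prodr_const_nat; apply: eq_big_nat => q q_gap.
by rewrite (negPf (ascent_gap iK q_gap)).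
Qed.

Lemma merged_words_diag i : (i <= K)%N ->
  merged_words i i = (U * suffix_mx (s i).+1) ord0 z.
Proof.
move=> iK; rewrite suffix_mx_gap // mulrA -exprS.
by rewrite /merged_words; congr ((U ^+ _ * _) _ _); have := s_lt iK; lia.
Qed.

(** The left-hand side counts the words with no condition at [s j.+1]; the two
    terms on the right have a descent there, respectively an ascent. *)
Lemma merged_words_split i j : (i <= j < K)%N ->
  'C(s j.+1 - s i + b, b)%:R * merged_words j.+1 j.+1
    = merged_words i j + merged_words i j.+1.
Proof.
case/andP=> ij jK; have s_ij : (s i <= s j.+1)%N by apply: breakpoint_mono; lia.
have s_jn : (s j.+1 < n)%N.
  by rewrite -sK; apply: leq_trans (s_lt jK) _; apply: breakpoint_mono; lia.
rewrite merged_words_diag // -(ascending_words_last _ ord_max) -mul_const_mx_split.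
rewrite -step_mxD mulrDr mulrDl mxE; congr (_ + _).
  by rewrite /merged_words /suffix_mx [in RHS]big_ltn ?mulrA ?desc_s // ltnS ltnW.
rewrite suffix_mx_gap // -exprSr mulrA -exprD /merged_words.
by congr ((U ^+ _ * _) _ _); have := s_lt jK; lia.
Qed.

(** The condition at [n] only enters through the last column, and is left
    arbitrary here. *)
Theorem det_descent_pattern :
  (\prod_(0 <= q < n.+1) step_mx b (desc q)) ord0 z
    = \det (\matrix_(i < K.+1, j < K.+1)
              if (j < K)%N
              then if (s i <= s j.+1)%N then 'C(s j.+1 - s i + b, b)%:R else 0
              else (U ^+ (n - s i) * step_mx b (desc n)) ord0 z).
Proof.
have -> : \prod_(0 <= q < n.+1) step_mx b (desc q) = U * suffix_mx (s 0).+1.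
  by rewrite s0 big_ltn // (negPf desc0).
rewrite -merged_words_diag //; set M := \matrix_(i, j) _.
(* X extends merged_words by 0, which makes the splitting identity true for all
   j: it then also accounts for the ones below the diagonal and the zeros
   further down, as well as for the last column. *)
pose X i j := if (i <= j <= K)%N then merged_words i j else 0.
pose v : 'cV[rat]_K.+1 :=
  \col_j ((-1) ^+ j * if (j < K)%N then merged_words j.+1 j.+1 else 1).
have Mv i j : M i j * v j 0 = (-1) ^+ j * (X i j + X i j.+1).
  rewrite mxE [v j 0]mxE mulrCA; congr (_ * _); rewrite /X.
  have [jK|Kj] := ltnP j K.
    have [ij|ji|ij] := ltngtP i j.+1.
    - have le_ij : (i <= j)%N by [].
      rewrite le_ij (ltnW jK) -merged_words_split ?le_ij //.
      by rewrite breakpoint_mono // (ltnW ij) ltnS ltnW.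
    - rewrite [(i <= j)%N]leqNgt (ltnW ji) /= addr0 ifF ?mul0r //.
      apply: negbTE; rewrite -ltnNge; apply: leq_trans (s_lt jK) _.
      by apply: breakpoint_mono; rewrite ji ltnW.
    - by rewrite ij leqnn subnn add0n binn mul1r ltnn add0r.
  have -> : nat_of_ord j = K by apply/eqP; rewrite eqn_leq Kj -ltnS ltn_ord.
  rewrite -ltnS ltn_ord leqnn andbF addr0 mulr1 /merged_words sK.
  by rewrite /suffix_mx big_nat1.
symmetry; apply: (@det_unit_hessenberg _ _ M v).
- move=> i j ij; rewrite mxE ij leqnn subnn add0n binn ifT //.
  by rewrite -ltnS -ij ltn_ord.
- move=> i j ji; have jK : (j < K)%N by rewrite -ltnS (leq_trans ji) // ltnW.
  rewrite mxE jK ifF //; apply: negbTE; rewrite -ltnNge.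
  by apply: leq_trans (s_lt jK) _; apply: breakpoint_mono; rewrite ji ltnW.
- apply/colP=> i; rewrite mxE [RHS]mxE [delta_mx 0 0 i 0]mxE.
  rewrite (eq_bigr _ (fun j _ => Mv i j)).
  pose T j := - (-1) ^+ j * X i j.
  rewrite -(big_mkord predT (fun j => (-1) ^+ j * (X i j + X i j.+1))).
  rewrite (telescope_sumr_eq T) // => [|j _]; last first.
    by rewrite /T exprS; ring.
  rewrite /T expr0 /X ltnn andbF mulr0 sub0r mulN1r opprK leqn0 /= andbT.
  by case: eqP => [->|_]; rewrite ?mulr1 ?mulr0.
by rewrite mxE ltnn mulr1.
Qed.

End DescentPattern.

(** * From shuffles to words *)

Section Relabelling.
Variables (p c : nat).
Hypothesis p_gt0 : (0 < p)%N.

(** The place of the color of the label [a] in the order 0, p-1, ..., 1 of the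
    colors. *)
Definition color_rank a : nat := ((p - a %% p) %% p)%N.

(** The number of labels that precede [a]: there are [c.+1] multiples of [p] and
    [c] labels in each other class, and [a %/ p] labels below [a] in its own
    class. *)
Definition relabel_nat a : nat :=
  (color_rank a * c + (0 < color_rank a) + a %/ p)%N.

Lemma color_rankP a : (a < (p * c).+1)%N ->
  (color_rank a = 0 /\ a = a %/ p * p /\ a %/ p <= c)%N \/
  (0 < color_rank a < p /\ a = a %/ p * p + (p - color_rank a) /\ a %/ p < c)%N.
Proof.
rewrite /color_rank => a_lt; have := ltn_pmod a p_gt0.
have := divn_eq a p; move: (a %/ p)%N (a %% p)%N => q r aE r_lt.
have [r0|r_gt0] := posnP r; [left | right].
  rewrite r0 subn0 modnn; split=> //; split; first by rewrite aE r0 addn0.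
  by rewrite -(leq_pmul2l p_gt0) mulnC -ltnS -[(q * p)%N]addn0 -r0 -aE.
rewrite modn_small; last lia.
split; first lia; split; first by rewrite aE; lia.
by rewrite -(ltn_pmul2l p_gt0) mulnC; lia.
Qed.

Lemma relabel_nat_lt a : (a < (p * c).+1)%N -> (relabel_nat a < (p * c).+1)%N.
Proof. by rewrite /relabel_nat => /color_rankP[] [? ?]; nia. Qed.

Lemma relabel_nat_le a : (a < (p * c).+1)%N ->
  (relabel_nat a <= c)%N = (color_rank a == 0)%N.
Proof.
rewrite /relabel_nat => /color_rankP[[-> [_ ->]] // | [/andP[t_gt0 _] _]].
have : (c <= color_rank a * c)%N by rewrite leq_pmull.
rewrite eqn0Ngt t_gt0 /= addn1 => c_le; apply/negbTE.
by rewrite -ltnNge addSn ltnS (leq_trans c_le) ?leq_addr.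
Qed.

Lemma ltn_relabel_nat a a' : (a < (p * c).+1)%N -> (a' < (p * c).+1)%N ->
  (relabel_nat a < relabel_nat a')%N
    = (color_rank a < color_rank a')%N
      || (color_rank a == color_rank a') && (a < a')%N.
Proof.
rewrite /relabel_nat => /color_rankP aP /color_rankP a'P.
move: (color_rank a) (color_rank a') (a %/ p)%N (a' %/ p)%N aP a'P => t t' q q'.
have [tt'|t't|<-] := ltngtP t t'; rewrite /= ?ltn_add2l.
- have : (t.+1 * c <= t' * c)%N by rewrite leq_mul2r tt' orbT.
  by move=> ? [] ? [] ?; lia.
- have : (t'.+1 * c <= t * c)%N by rewrite leq_mul2r t't orbT.
  by move=> ? [] ? [] ?; lia.
move=> [] [? [-> ?]] [] [? [-> ?]]; try lia.
  by rewrite ltn_pmul2r.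
by rewrite ltn_add2r ltn_pmul2r.
Qed.

Definition relabel (a : 'I_(p * c).+1) : 'I_(p * c).+1 :=
  Ordinal (relabel_nat_lt (ltn_ord a)).

Lemma relabel_inj : injective relabel.
Proof.
move=> a a' /(congr1 val) /= e; apply: val_inj => /=; apply/eqP.
have := ltn_relabel_nat (ltn_ord a) (ltn_ord a').
have := ltn_relabel_nat (ltn_ord a') (ltn_ord a).
rewrite e ltnn; case: ltngtP => //= _; case: ltngtP => //.
Qed.

Lemma val_opp_inZp a : (- (inZp a : color p) : color p) = color_rank a :> nat.
Proof. by rewrite /= /color_rank prednK. Qed.

Section Descents.
Variables (n : nat) (A : {ffun 'I_n -> 'I_(p * c).+1}).

Lemma entry_shuffle i : entry (shuffle p A) i = (shuffle_rank A i, inZp (A i)).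
Proof. by rewrite /entry /= permE /shuffle_fun /shift /= addr0. Qed.

(** Sorting is stable, so equal labels never create an inversion. *)
Lemma shuffle_rank_lt (i j : 'I_n) : (i < j)%N ->
  (shuffle_rank A j < shuffle_rank A i)%N = (A j < A i)%N.
Proof.
move=> ij.
have le_total : total (label_le A).
  by move=> u v; rewrite /label_le -!val_eqE; case: ltngtP; case: ltngtP.
have le_trans : transitive (label_le A).
  by move=> u v w; rewrite /label_le -!val_eqE /=; lia.
have rankP u v : (shuffle_rank A u < shuffle_rank A v)%N -> label_le A u v.
  by apply: (sorted_ltn_index le_trans (sort_sorted le_total _));
     rewrite mem_sort mem_enum.
apply/idP/idP => [/rankP|Aji].
  by rewrite /label_le -val_eqE /=; lia.
rewrite ltnNge leq_eqVlt negb_or; apply/andP; split.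
  by apply: contraTneq ij => /val_inj/shuffle_rank_inj->; rewrite ltnn.
by apply: contraL Aji => /rankP; rewrite /label_le -val_eqE /=; lia.
Qed.

Lemma d_descent_shuffle (i : 'I_n) : (i.+1 < n)%N ->
  d_descent (shuffle p A) i = (relabel (A (ordS i)) < relabel (A i))%N.
Proof.
move=> i_lt; rewrite /d_descent i_lt /letter_lt !entry_shuffle.
cbn [fst snd]; rewrite -(inj_eq oppr_inj) -(inj_eq (@ord_inj _)) !val_opp_inZp.
rewrite shuffle_rank_lt /=; last by rewrite modn_small.
by rewrite ltn_relabel_nat.
Qed.

Lemma d_descent_shuffle_last (i : 'I_n) : i.+1 = n ->
  d_descent (shuffle p A) i = (c < relabel (A i))%N.
Proof.
move=> i_last; rewrite /d_descent i_last ltnn entry_shuffle; cbn [fst snd].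
by rewrite -oppr_eq0 -(inj_eq (@ord_inj _)) val_opp_inZp ltnNge relabel_nat_le.
Qed.

End Descents.

(** After relabelling, [c] as a last virtual letter detects the d-descent at [n],
    and 0 as a first one adds no constraint since nothing lies below it. *)
Lemma card_d_descent_set n (S : {set 'I_n}) (desc : nat -> bool) :
  ~~ desc 0 -> (forall i : 'I_n, (i \in S) = desc i.+1) ->
  #|[set A : {ffun 'I_n -> 'I_(p * c).+1} |
      d_descent_set (shuffle p A) == S]|%:R
    = (\prod_(0 <= q < n.+1) step_mx (p * c) (desc q)) ord0 (inord c).
Proof.
move=> desc0 descS.
pose word (A : {ffun 'I_n -> 'I_(p * c).+1}) := [tuple relabel (A i) | i < n].
have word_bij : bijective word.
  apply: inj_card_bij => [A A' eqAA'|].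
    apply/ffunP=> i; apply: relabel_inj.
    by have := congr1 (fun t => tnth t i) eqAA'; rewrite /= !tnth_mktuple.
  by rewrite card_tuple card_ffun !card_ord.
have -> : \prod_(0 <= q < n.+1) step_mx (p * c) (desc q)
    = \prod_(d <- mkseq desc n.+1) step_mx (p * c) d.
  by rewrite big_map /index_iota subn0.
rewrite -(@card_words_step_mx _ n) ?size_mkseq //.
rewrite -(on_card_preimset (onW_bij _ word_bij)); congr (_%:R); apply: eq_card => A.
rewrite !inE.
have c_lt : (c < (p * c).+1)%N by rewrite ltnS leq_pmull.
have nth_word x (i : 'I_n) : nth x (rcons (word A) (inord c)) i = relabel (A i).
  by rewrite nth_rcons size_tuple ltn_ord -tnth_nth tnth_mktuple.
have pairmapE (i : 'I_n) : nth false (pairmap (fun u v : 'I_(p * c).+1 => (v < u)%N)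
    ord0 (rcons (word A) (inord c))) i.+1 = d_descent (shuffle p A) i.
  rewrite (nth_pairmap ord0) ?size_rcons ?size_tuple ?ltnS //.
  rewrite [nth _ (_ :: _) _]/= nth_word.
  have [i_last|i_lt] := eqVneq i.+1 n.
    rewrite d_descent_shuffle_last // i_last nth_rcons size_tuple ltnn eqxx.
    by rewrite inordK.
  have i1_lt : (i.+1 < n)%N by rewrite ltn_neqAle i_lt ltn_ord.
  rewrite d_descent_shuffle // -(nth_word ord0 (ordS i)) /=.
  by rewrite modn_small.
apply/eqP/eqP=> [dS|wordE].
  apply: (@eq_from_nth _ false) => [|q].
    by rewrite size_pairmap size_rcons size_tuple size_mkseq.
  rewrite size_pairmap size_rcons size_tuple => q_lt; rewrite nth_mkseq //.
  case: q q_lt => [|i] i_lt.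
    by rewrite (nth_pairmap ord0) ?size_rcons ?size_tuple //= ltn0 (negPf desc0).
  have i_n : (i < n)%N by [].
  by rewrite (pairmapE (Ordinal i_n)) -(descS (Ordinal i_n)) -dS inE.
apply/setP=> i; rewrite inE -pairmapE wordE nth_mkseq ?ltnS //.
Qed.

End Relabelling.

(** * The probability of a d-descent set *)

Lemma binz_segment (b m l : nat) :
  binz (m%:Z - l%:Z + b.+1%:Z - 1) b = if (l <= m)%N then 'C(m - l + b, b)%:R else 0.
Proof.
have -> : m%:Z - l%:Z + b.+1%:Z - 1 = (m + b)%N%:Z - l%:Z by lia.
case: leqP => [lm | ml]; first by rewrite subzn /= ?addnBAC // (leq_trans lm) ?leq_addr.
have [lb|bl] := leqP l (m + b); first by rewrite subzn //= bin_small //; lia.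
have -> : (m + b)%N%:Z - l%:Z = Negz (l - (m + b)).-1 by lia.
by [].
Qed.

Lemma binz_last (c n l : nat) : (l <= n)%N ->
  binz (n%:Z - l%:Z + c%:Z) c = 'C(n - l + c, c)%:R.
Proof. by move=> ln; rewrite subzn. Qed.

Theorem theorem1p1 (n p c b k : nat) (s : nat -> nat)
  (hn : (0 < n)%N) (hp : (0 < p)%N) (hc : (0 < c)%N)
  (hb : b = (p * c + 1)%N)
  (hk : (1 <= k <= n)%N)
  (hs0 : s 0%N = 0%N) (hsk1 : s k.+1 = n)
  (hs_incr : forall i : nat, (i < k)%N -> (s i < s i.+1)%N)
  (hsk : (s k <= n)%N) :
  ((s k < n)%N ->
    prob_d_descent_set b p (positions n k s) =
    1 / b%:R ^+ n *
    \det (\matrix_(i < k.+1, j < k.+1)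
            if (j < k)%N
            then binz ((s j.+1)%:Z - (s i)%:Z + b%:Z - 1) (b - 1)
            else binz (n%:Z - (s i)%:Z + c%:Z) c))
  /\
  (s k = n ->
    prob_d_descent_set b p (positions n k s) =
    1 / b%:R ^+ n *
    \det (\matrix_(i < k, j < k)
            if (j < k - 1)%N
            then binz ((s j.+1)%:Z - (s i)%:Z + b%:Z - 1) (b - 1)
            else binz (n%:Z - (s i)%:Z + b%:Z - 1) (b - 1)
                 - binz (n%:Z - (s i)%:Z + c%:Z) c)).
Proof.
have s_mono i j : (i <= j <= k)%N -> (s i <= s j)%N.
  case/andP=> ij jk; apply: (@breakpoint_mono k.-1 s) => [l lk|]; last by lia.
  by apply: hs_incr; lia.
pose desc q := [exists m : 'I_k, q == s m.+1].
have desc_s i : (0 < i <= k)%N -> desc (s i).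
  by case: i => // i ik; apply/existsP; exists (Ordinal ik).
(* For i = k there is no further breakpoint: both s k < n and s k = n occur. *)
have ascent_gap i q :
  (i <= k)%N -> (s i < q)%N -> (i < k -> q < s i.+1)%N -> ~~ desc q.
  move=> ik iq qi; apply/existsP=> -[m /eqP qE].
  have [mi|im] := ltnP m i; first by have := s_mono m.+1 i; lia.
  by have := s_mono i.+1 m.+1; have := ltn_ord m; lia.
have desc0 : ~~ desc 0.
  apply/existsP=> -[m /eqP sm0].
  by have := hs_incr _ (ltn_ord m); rewrite -sm0.
have c_lt : (c < (p * c).+1)%N by rewrite ltnS leq_pmull.
rewrite addn1 in hb; subst b; rewrite subn1 /=.
rewrite /prob_d_descent_set /uniform_prob card_ffun !card_ord natrX.
rewrite (card_d_descent_set c hp desc0); last by move=> i; rewrite inE.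
split=> [skn|skn]; rewrite mulrC div1r; congr (_ * _).
  rewrite (@det_descent_pattern _ n k s desc) //; last 2 first.
  - move=> i; rewrite leq_eqVlt => /predU1P[->|/hs_incr //].
    by rewrite hsk1.
  - by move=> i q ik /andP[iq qi]; apply: ascent_gap ik iq _.
  congr (\det _); apply/matrixP=> i j; rewrite [LHS]mxE [RHS]mxE; case: ifP => _.
    by rewrite binz_segment.
  have s_in : (s i <= n)%N.
    by apply: leq_trans hsk; apply: s_mono; rewrite -ltnS ltn_ord leqnn.
  have -> : desc n = false.
    by apply: negbTE; apply: ascent_gap (leqnn k) skn _; rewrite ltnn.
  by rewrite binz_last // ascending_words_last inordK.
(* The breakpoint s k = n is the end of the word, and k - 1 of them are inner. *)
case: k => [|k] in hk hsk1 hs_incr hsk desc s_mono desc_s ascent_gap desc0 skn *.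
  by [].
rewrite subn1 /=.
rewrite (@det_descent_pattern _ n k s desc) //; last 2 first.
- by move=> i /andP[i_gt0 ik]; apply: desc_s; rewrite i_gt0 ltnW.
- by move=> i q ik /andP[iq qi]; apply: (ascent_gap i q) => //; apply: ltnW.
congr (\det _); apply/matrixP=> i j; rewrite [LHS]mxE [RHS]mxE; case: ifP => _.
  by rewrite binz_segment.
have s_in : (s i <= n)%N by rewrite -skn; apply: s_mono; rewrite leqnn ltnW.
have -> : desc n by rewrite -skn; apply: desc_s; rewrite leqnn.
by rewrite descending_words_last binz_last // binz_segment s_in inordK.
Qed.
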